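(* Let $G$ and $G'$ be finitely generated Abelian groups of non-zero rank. Then the following are equivalent: (i) $G$ and $G'$ admit equal growth functions with respect to symmetric generating sets, i.e., there exist a finite symmetric generating set $S \subset G$ of $G$ and a finite symmetric generating set $S' \subset G'$ of $G'$ such that $\beta_{G,S}(r) = \beta_{G',S'}(r)$ for all $r \in \mathbb{N}$; (ii) $\operatorname{rk} G = \operatorname{rk} G'$ and $|\operatorname{tors} G| \equiv |\operatorname{tors} G'| \pmod 2$.
   Context: $\mathbb{N}$ contains $0$. A subset $A$ of a group is symmetric if $g^{-1} \in A$ for all $g \in A$. For a finitely generated group $G$ with neutral element $e$ and a finite monoid generating set $S \subset G$ (i.e., every element of $G$ is a finite, possibly empty, product of elements of $S$; a symmetric generating set of a group is in particular a monoid generating set), define $d_S(g,h) := \min\{ n \in \mathbb{N} \mid \exists s_1,\dots,s_n \in S : h^{-1} g = s_1 \cdots s_n\}$ for $g,h \in G$. The ball of radius $r \in \mathbb{N}$ is $B_{G,S}(r) := \{ g \in G \mid d_S(g,e) \le r\}$, and the growth function of $G$ with respect to $S$ is $\beta_{G,S} \colon \mathbb{N} \to \mathbb{N}$, $\beta_{G,S}(r) := |B_{G,S}(r)|$. For a finitely generated Abelian group $G$, $\operatorname{tors} G$ denotes the (finite) subgroup of all elements of finite order, and $\operatorname{rk} G$ denotes the rank of the free Abelian group $G/\operatorname{tors} G$. *)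

(* Defs.v *)
From HB Require Import structures.
From mathcomp Require Import all_boot all_order all_algebra finmap ring_quotient.
From mathcomp Require Import boolp classical_sets cardinality.

Set Implicit Arguments.
Unset Strict Implicit.
Unset Printing Implicit Defensive.

Import GRing.Theory.
Local Open Scope ring_scope.
Local Open Scope classical_set_scope.

(* Abelian groups are zmodTypes, written additively: the neutral element is 0,
   g^-1 is - g, and the product s_1 ... s_n is \sum_i s_i. *)

(* Generation as a group: inverses of elements of S are allowed. *)
Definition generates (G : zmodType) (S : {fset G}) : Prop :=
  forall g : G, exists s : seq G,
    (forall x, x \in s -> x \in S \/ - x \in S) /\ g = \sum_(x <- s) x.

Definition finitely_generated (G : zmodType) : Prop :=
  exists S : {fset G}, generates S.

Definition symmetric_subset (G : zmodType) (S : {fset G}) : Prop :=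
  forall g : G, g \in S -> - g \in S.

(* The least element of P; 0 if P is empty. *)
Definition min_nat (P : set nat) : nat :=
  xget 0%N [set n | P n /\ forall m, P m -> (n <= m)%N].

Definition dist (G : zmodType) (S : {fset G}) (g h : G) : nat :=
  min_nat [set n | exists s : 'I_n -> G,
    (forall i, s i \in S) /\ - h + g = \sum_(i < n) s i].

Definition ball (G : zmodType) (S : {fset G}) (r : nat) : set G :=
  [set g | (dist S g 0 <= r)%N].

(* fset_set A is the finite set A, and is empty when A is infinite. Balls for a
   generating symmetric S are finite (ball_finite below). *)
Definition growth (G : zmodType) (S : {fset G}) (r : nat) : nat :=
  #|` fset_set (ball S r)|%fset.

Definition tors (G : zmodType) : {pred G} :=
  fun x => `[< exists n : nat, (0 < n)%N /\ x *+ n = 0 >].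
Arguments tors : clear implicits.

Lemma tors_zmod_closed (G : zmodType) : zmod_closed (tors G).
Proof.
split=> [|x y /asboolP[m [m0 xm]] /asboolP[n [n0 yn]]].
  by apply/asboolP; exists 1%N.
apply/asboolP; exists (m * n)%N; rewrite muln_gt0 m0 n0; split=> //.
by rewrite mulrnBl mulrnA xm mul0rn mulnC mulrnA yn mul0rn subr0.
Qed.

HB.instance Definition _ (G : zmodType) :=
  GRing.isZmodClosed.Build G (tors G) (tors_zmod_closed G).

Definition tors_order (G : zmodType) : nat :=
  #|` fset_set [set x : G | x \in tors G]|%fset.

Definition is_basis (A : zmodType) (n : nat) (b : 'I_n -> A) : Prop :=
  forall a : A, exists! c : {ffun 'I_n -> int}, a = \sum_(i < n) b i *~ c i.

(* The rank of a free Abelian group A; 0 if A has no finite basis. *)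
Definition free_rank (A : zmodType) : nat :=
  xget 0%N [set n | exists b : 'I_n -> A, is_basis b].

(* Quotient.quot (tors G) is the group G / tors G. *)
Definition rk (G : zmodType) : nat := free_rank (Quotient.quot (tors G)).

Lemma min_natP (P : set nat) : (exists n, P n) ->
  P (min_nat P) /\ forall m, P m -> (min_nat P <= m)%N.
Proof.
move=> [n Pn].
have ex : exists n, `[< P n >] by exists n; apply/asboolP.
pose Q : set nat := [set n | P n /\ forall m, P m -> (n <= m)%N].
suff : Q (xget 0%N Q) by [].
apply: xgetPex; case: (ex_minnP ex) => m /asboolP Pm le.
by exists m; split=> // k Pk; apply: le; apply/asboolP.
Qed.

Lemma distP (G : zmodType) (S : {fset G}) (g h : G) :
  generates S -> symmetric_subset S ->
  exists s : 'I_(dist S g h) -> G,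
    (forall i, s i \in S) /\ - h + g = \sum_(i < dist S g h) s i.
Proof.
move=> genS symS.
pose P : set nat := [set n | exists s : 'I_n -> G,
  (forall i, s i \in S) /\ - h + g = \sum_(i < n) s i].
suff /min_natP[] : exists n, P n by [].
have [s [sS sE]] := genS (- h + g).
exists (size s), (fun i => s`_i); split=> [i|]; last first.
  by rewrite sE (big_nth 0) big_mkord.
have [//|] := sS _ (mem_nth 0 (ltn_ord i)).
by move/symS; rewrite opprK.
Qed.

Lemma ball_finite (G : zmodType) (S : {fset G}) (r : nat) :
  generates S -> symmetric_subset S -> finite_set (ball S r).
Proof.
move=> genS symS.
pose f (u : {k : 'I_r.+1 & {ffun 'I_k -> S}}) : G :=
  \sum_(i < tag u) val (tagged u i).
apply: (@sub_finite_set _ _ (range f)); last first.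
  by apply: finite_image; apply: finite_finset.
move=> g; rewrite /ball /= => gr.
have [s [sS]] := distP g 0 genS symS; rewrite oppr0 add0r => gE.
have lt : (dist S g 0 < r.+1)%N by [].
exists (Tagged (fun k : 'I_r.+1 => {ffun 'I_k -> S})
  (i := Ordinal lt) [ffun i => [` sS i]%fset]) => //.
by rewrite [RHS]gE; apply: eq_bigr => i _; rewrite ffunE.
Qed.

(* Main.v *)
Require Import Defs.
From HB Require Import structures.
From mathcomp Require Import all_boot all_order all_algebra finmap.
From mathcomp Require Import generic_quotient ring_quotient boolp classical_sets cardinality.
From mathcomp Require Import zify.

Set Implicit Arguments.
Unset Strict Implicit.
Unset Printing Implicit Defensive.

Import Order.TTheory GRing.Theory Num.Theory.

(** A finitely generated Abelian group G of rank d is Z^d x tors G, with tors G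
  finite.  Everything below takes place in coordinates for this splitting.

  Equal growth forces equal invariants.  The growth function lies between
  constant multiples of r^d (growth_ge, growth_le), so it determines d
  (rank_le).  A ball is stable under the involution g -> - g, so its size has
  the parity of its number of fixed points (odd_card_involution); these are
  torsion elements and all lie in the ball once the radius is large, and the
  same count computes the parity of |tors G| (odd_growth).

  Conversely, single out one coordinate x in Z, write t for the torsion part,
  and let the generating set be {-1,0,1}^(d-1) x U with
  U contained in [-M, M] x tors G.  The shape of U near its two ends is all
  that matters.  At depth i below the end x = M, the set U contains only t = 0
  for i = 0, nothing for 0 < i < L, everything outside a prescribed subset A of
  tors G for i = L, and everything for i > L; the end x = - M is the mirror
  image.  Depths add up under addition of elements near the same end, and two
  nonzero admissible depths add up to more than L; hence the r-fold sums of U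
  have the same profile at their ends x = rM and x = - rM, and the ball of
  radius r is [-r, r]^(d-1) times the r-fold sums of U
  (target_ball_generating_set).  With n = |tors G| its size is, for r > 0,
  (2r+1)^(d-1) (2rMn + n - 2nL + 2 - 2|A|), which depends on nM, nL and
  n - 2|A| only.  For a second group with n' = |tors G'| of the same parity,
  take L = n', M = 3n' in G and L' = n, M' = 3n in G', and remove |n - n'| / 2
  torsion elements in the group with the larger torsion, so that
  n - 2|A| = min(n, n') = n' - 2|A'|. *)

(** * Cardinals of finite sets *)

Section FiniteSets.
Local Open Scope classical_set_scope.

Lemma card_fset_set_image (F : finType) (T : choiceType) (D : {set F})
    (f : F -> T) (A : set T) :
  {in D &, injective f} -> (forall g, A g <-> exists2 u, u \in D & g = f u) ->
  finite_set A /\ #|` fset_set A|%fset = #|D|.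
Proof.
move=> injf memA.
have -> : A = [set` [fset f u | u in D]%fset].
  rewrite predeqE => g; rewrite memA; split=> /= [[u uD ->]|/imfsetP[u /= uD ->]].
    by apply/imfsetP; exists u.
  by exists u.
split; first exact: finite_fset.
by rewrite set_fsetK card_in_imfset //= cardE.
Qed.

Lemma card_fset_set_le (F : finType) (T : choiceType) (f : F -> T) (A : set T) :
  A `<=` range f -> (#|` fset_set A|%fset <= #|F|)%N.
Proof.
move=> Af; have finf : finite_set (range f) by apply/finite_image/finite_finset.
have := leq_imfset_card imfset_key f (mem F); rewrite /= -cardE; apply: leq_trans.
apply: fsubset_leq_card; apply/fsubsetP => g.
rewrite in_fset_set ?inE; last exact: sub_finite_set finf.
by move=> /Af[u _ <-]; apply/imfsetP; exists u.
Qed.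

Lemma card_fset_set_ge (F : finType) (T : choiceType) (f : F -> T) (A : set T) :
  finite_set A -> injective f -> range f `<=` A -> (#|F| <= #|` fset_set A|%fset)%N.
Proof.
move=> finA injf fA.
have -> : #|F| = #|` [fset f u | u : F]|%fset.
  by rewrite card_imfset //= -cardE.
apply: fsubset_leq_card; apply/fsubsetP => _ /imfsetP[u _ ->].
by rewrite in_fset_set // inE; apply: fA; exists u.
Qed.

Lemma fsubset_of_card (K : choiceType) (T : {fset K}) (k : nat) :
  (k <= #|` T|)%fset -> exists2 A : {fset K}, (A `<=` T)%fset & #|` A|%fset = k.
Proof.
move=> kT; exists [fset x in take k (enum_fset T)]%fset.
  by apply/fsubsetP => x; rewrite !inE => /mem_take.
by rewrite card_fseq undup_id ?take_uniq ?fset_uniq // size_takel.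
Qed.

(** The points moved by an involution come in pairs. *)
Lemma odd_card_involution (K : choiceType) (f : K -> K) (A : {fset K}) :
    {in A, forall x, f x \in A} -> {in A, involutive f} ->
  odd #|` A|%fset = odd #|` [fset x in A | f x == x]|%fset.
Proof.
elim: {A}_.+1 {-2}A (ltnSn #|` A|%fset) => // k IH A leAk fA fK.
have [/forallP fixA|] := boolP [forall x : A, f (val x) == val x].
  congr (odd #|` _|%fset); apply/fsetP=> x; rewrite !inE.
  by case: (boolP (x \in A)) => //= xA; move: (fixA [` xA]%fset) => /= ->.
case/forallPn=> -[x xA] /= fxx.
have [fxA ffx] := (fA x xA, fK x xA).
pose B := (A `\ x `\ f x)%fset.
have cardA : #|` A|%fset = #|` B|%fset.+2.
  by rewrite (cardfsD1 x) xA (cardfsD1 (f x)) !inE fxx fxA.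
rewrite cardA /= negbK IH; first last.
- by move=> y; rewrite !inE => /and3P[_ _ /fK].
- move=> y; rewrite !inE => /and3P[y1 y2 yA]; rewrite (fA y yA) andbT.
  apply/andP; split; first by apply: contra_neq y2 => e; rewrite -(fK _ yA) e.
  by apply: contra_neq y1 => <-; rewrite fK.
- by rewrite cardA in leAk; lia.
congr (odd #|` _|%fset); apply/fsetP=> y; rewrite !inE.
have [->|] := eqVneq y (f x); first by rewrite ffx (eq_sym x) (negPf fxx) !andbF.
by have [->|] := eqVneq y x; rewrite ?(negPf fxx) ?andbF.
Qed.

End FiniteSets.

Local Open Scope ring_scope.
Local Open Scope classical_set_scope.

Definition tors_fset (G : zmodType) : {fset G} := fset_set [set g : G | g \in tors G].

Lemma in_tors_fset (G : zmodType) (g : G) :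
  finite_set [set g : G | g \in tors G] -> (g \in tors_fset G) = (g \in tors G).
Proof. by move=> finT; rewrite in_fset_set //; apply/idP/idP => [/set_mem|/mem_set]. Qed.

(** * Balls *)

Section Balls.
Variables (G : zmodType) (S : {fset G}).
Hypotheses (genS : generates S) (symS : symmetric_subset S).

Lemma ballP r g : ball S r g <->
  exists s : seq G, [/\ (size s <= r)%N, {subset s <= S} & g = \sum_(x <- s) x].
Proof.
split=> [gr|[s [sr sS gE]]]; last rewrite /ball /= /dist.
  have [s [sS]] := distP g 0 genS symS; rewrite oppr0 add0r => gE.
  exists (map s (enum 'I_(dist S g 0))); split; first by rewrite size_map size_enum_ord.
    by move=> x /mapP[i _ ->].
  by rewrite big_map big_enum.
pose P : set nat := [set n | exists s : 'I_n -> G,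
  (forall i, s i \in S) /\ - 0 + g = \sum_(i < n) s i].
apply: leq_trans sr.
have Ps : P (size s).
  exists (fun i => s`_i); split=> [i|]; first exact/sS/mem_nth.
  by rewrite oppr0 add0r gE (big_nth 0) big_mkord.
have /min_natP[_] : exists n, P n by exists (size s).
exact.
Qed.

Lemma sub_ball r r' g : (r <= r')%N -> ball S r g -> ball S r' g.
Proof. by move=> rr' /leq_trans; apply. Qed.

Lemma ballN r g : ball S r g -> ball S r (- g).
Proof.
move=> /ballP[s [sr sS ->]]; apply/ballP; exists (map -%R s); split.
- by rewrite size_map.
- by move=> x /mapP[y /sS/symS Sy ->].
- by rewrite big_map sumrN.
Qed.

Lemma ball0 r : ball S r 0.
Proof. by apply/ballP; exists [::]; rewrite big_nil. Qed.

Lemma ballD r r' g h : ball S r g -> ball S r' h -> ball S (r + r') (g + h).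
Proof.
move=> /ballP[s [sr sS ->]] /ballP[s' [sr' sS' ->]].
apply/ballP; exists (s ++ s'); split; last by rewrite big_cat.
- by rewrite size_cat leq_add.
- by move=> x; rewrite mem_cat => /orP[/sS|/sS'].
Qed.

Lemma ballMn r k g : ball S r g -> ball S (r * k) (g *+ k).
Proof.
move=> gr; elim: k => [|k IH]; first by rewrite mulr0n; apply: ball0.
by rewrite mulrS mulnS; apply: ballD.
Qed.

(** As S generates, every element lies in some ball, hence finitely many of them
  lie in a common one. *)
Lemma finite_sub_ball (A : {fset G}) :
  exists r, forall g, g \in A -> ball S r g.
Proof.
exists (\max_(g <- A) dist S g 0)%N => g gA; rewrite /ball /=.
by apply: (leq_bigmax_seq (F := fun g => dist S g 0)).
Qed.

Lemma in_growth r g :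
  (g \in fset_set (ball S r)) = `[< ball S r g >].
Proof.
rewrite in_fset_set; last exact: ball_finite.
by apply/idP/asboolP; rewrite inE.
Qed.

End Balls.

Lemma raddfMz_int (G : zmodType) (f : {additive G -> int}) (g : G) (k : int) :
  f (g *~ k) = f g * k.
Proof. by rewrite raddfMz mulrzz. Qed.

(** * Splitting off the torsion *)

(** A splitting of G as Z^d x tors G, given by lifts to G of a basis of G / tors G
  and by the coordinates with respect to that basis; an element with zero
  coordinates is torsion.  Keeping G itself, with the coordinates as additive
  maps, avoids transporting growth along an isomorphism. *)
Record coordinates (G : zmodType) (d : nat) := Coordinates {
  base : 'I_d -> G;
  coord : 'I_d -> {additive G -> int};
  coord_base : forall i j, coord j (base i) = (i == j)%:R;
  coord_tors : forall g, (forall j, coord j g = 0) -> g \in tors G }.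

Section BasisCoordinates.
Variables (A : zmodType) (d : nat) (b : 'I_d -> A) (bP : is_basis b).

Definition basis_coord (i : 'I_d) (a : A) : int := sval (cid (bP a)) i.

Lemma basis_coordK a : a = \sum_i b i *~ basis_coord i a.
Proof. by rewrite /basis_coord; case: (cid _) => c []. Qed.

Lemma basis_coord_uniq a (c : 'I_d -> int) j :
  a = \sum_i b i *~ c i -> basis_coord j a = c j.
Proof.
move=> aE; rewrite /basis_coord; case: (cid _) => c' [_ /(_ (finfun c))] /= ->.
  by rewrite ffunE.
by rewrite aE; apply: eq_bigr => i _; rewrite ffunE.
Qed.

Lemma basis_coord_is_zmod_morphism i : zmod_morphism (basis_coord i).
Proof.
move=> x y; apply: (@basis_coord_uniq _ (fun i => basis_coord i x - basis_coord i y)).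
rewrite {1}(basis_coordK x) {1}(basis_coordK y) -sumrB.
by apply: eq_bigr => j _; rewrite mulrzBr.
Qed.

HB.instance Definition _ i :=
  GRing.isZmodMorphism.Build A int (basis_coord i) (basis_coord_is_zmod_morphism i).

End BasisCoordinates.

Section Coordinates.
Local Open Scope quotient_scope.
Variable (G : zmodType).

Lemma pi_tors (g : G) : \pi_(Quotient.quot (tors G)) g = 0 -> g \in tors G.
Proof.
move=> pg; rewrite -(subr0 g) Quotient.idealrBE.
by apply/eqP; rewrite pg raddf0.
Qed.

(** A nonzero value of rk can only come from an actual basis of G / tors G, since
  0 is the default value. *)
Lemma rk_coordinates : rk G <> 0%N -> inhabited (coordinates G (rk G)).
Proof.
set d := rk G => d0.
have [b bP] : exists b : 'I_d -> Quotient.quot (tors G), is_basis b.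
  by move: d0; rewrite /d /rk /free_rank; case: xgetP.
pose c i : {additive G -> int} := basis_coord bP i \o \pi_(Quotient.quot (tors G)).
constructor; apply: (@Coordinates _ _ (fun i => repr (b i)) c) => [i j|g cg].
  rewrite /c /= reprK; apply: (@basis_coord_uniq _ _ _ bP _ (fun j => (i == j)%:R)).
  rewrite (bigD1 i) //= eqxx mulr1z big1 ?addr0 // => k; rewrite eq_sym => /negPf->.
  by rewrite mulr0z.
apply: pi_tors; rewrite (basis_coordK bP (\pi g)) big1 // => i _.
by have /= -> := cg i; rewrite mulr0z.
Qed.

Variables (d : nat) (C : coordinates G d).

Definition lattice_point (a : 'I_d -> int) : G := \sum_i base C i *~ a i.

Lemma coord_lattice_point a j : coord C j (lattice_point a) = a j.
Proof.
rewrite raddf_sum (bigD1 j) //= raddfMz_int coord_base eqxx mul1r big1 ?addr0 //.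
by move=> i /negPf ij; rewrite raddfMz_int coord_base ij mul0r.
Qed.

Lemma eq_lattice_point a a' : a =1 a' -> lattice_point a = lattice_point a'.
Proof. by move=> aa; apply: eq_bigr => i _; rewrite aa. Qed.

Lemma coord0_tors g j : g \in tors G -> coord C j g = 0.
Proof.
move=> /asboolP[n [n0 gn]]; have := raddfMn (coord C j) n g; rewrite gn raddf0.
move/esym/eqP; rewrite mulrn_eq0 => /orP[/eqP nE|/eqP //].
by rewrite nE in n0.
Qed.

Definition torsion_part (g : G) : G := g - lattice_point (fun i => coord C i g).

Lemma torsion_part_tors g : torsion_part g \in tors G.
Proof.
by apply: (coord_tors (c := C)) => j; rewrite raddfB coord_lattice_point subrr.
Qed.

Lemma torsion_part_is_zmod_morphism : zmod_morphism torsion_part.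
Proof.
move=> x y; rewrite /torsion_part opprD addrACA -opprD; congr (_ - _).
rewrite -sumrB; by apply: eq_bigr => i _; rewrite raddfB mulrzBr.
Qed.

HB.instance Definition _ :=
  GRing.isZmodMorphism.Build G G torsion_part torsion_part_is_zmod_morphism.

Lemma torsion_part_id t : t \in tors G -> torsion_part t = t.
Proof.
move=> tT; rewrite /torsion_part /lattice_point big1 ?subr0 // => i _.
by rewrite coord0_tors ?mulr0z.
Qed.

Lemma torsion_part_lattice_point a : torsion_part (lattice_point a) = 0.
Proof.
apply/eqP; rewrite subr_eq0; apply/eqP/esym/eq_lattice_point => i.
exact: coord_lattice_point.
Qed.

Lemma coordinates_inj g h :
  (forall i, coord C i g = coord C i h) -> torsion_part g = torsion_part h -> g = h.
Proof.
by move=> eqc; rewrite /torsion_part (eq_lattice_point eqc) => /addIr.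
Qed.

(** The torsion part is additive and fixes tors G, so tors G is generated by the
  torsion parts of finitely many generators; each of these has finite order, so
  the exponents can be reduced modulo the orders. *)
Lemma tors_finite : finitely_generated G -> finite_set [set g : G | g \in tors G].
Proof.
move=> [S genS].
have span g : exists k : S -> int, g = \sum_(x : S) val x *~ k x.
  have [s [sS ->]] := genS g; elim: s sS => [|y s IH] sS.
    by exists (fun=> 0); rewrite big_nil big1 // => x _; rewrite mulr0z.
  have [|k kE] := IH; first by move=> x xs; apply: sS; rewrite inE xs orbT.
  have [e [z yE]] : exists (e : int) (z : S), y = val z *~ e.
    have [yS|yS] := sS y (mem_head _ _).
      by exists 1, [` yS]%fset; rewrite mulr1z.
    by exists (-1), [` yS]%fset; rewrite mulrNz mulr1z opprK.
  exists (fun x => (if x == z then e else 0) + k x); rewrite big_cons kE yE.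
  rewrite (eq_bigr _ (fun x _ => mulrzDr _ _ _)) big_split /=; congr (_ + _).
  by rewrite (bigD1 z) //= eqxx big1 ?addr0 // => x /negPf->; rewrite mulr0z.
have [n nP] := choice (fun x : S => asboolP _ (torsion_part_tors (val x))).
pose N := (\max_(x : S) n x)%N.
pose F (k : {ffun S -> 'I_N.+1}) : G := \sum_(x : S) torsion_part (val x) *+ k x.
apply: (@sub_finite_set _ _ (range F)); last first.
  by apply: finite_image; apply: finite_finset.
move=> t /= tT; have [k kE] := span t.
pose r x := `|(k x %% n x)%Z|%N.
have rE x : (r x)%:Z = (k x %% n x)%Z.
  by rewrite gez0_abs // modz_ge0 //; have [n0 _] := nP x; rewrite -lt0n.
have rN x : (r x < N.+1)%N.
  rewrite ltnS; apply: leq_trans (leq_bigmax x); rewrite -lez_nat rE ltW //.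
  by rewrite ltz_pmod //; have [] := nP x.
exists [ffun x => Ordinal (rN x)] => //.
rewrite -(torsion_part_id tT) kE raddf_sum; apply: eq_bigr => x _.
rewrite ffunE /= raddfMz [in RHS](divz_eq (k x) (n x)) mulrzDr -rE pmulrn.
by rewrite mulrC mulrzA -[X in X *~ (_ %/ _)%Z]pmulrn; have [_ ->] := nP x; rewrite mul0rz add0r.
Qed.

End Coordinates.

(** * Growth determines rank and parity of the torsion *)

Lemma leq_wexp2r d m n : (m <= n)%N -> (m ^ d <= n ^ d)%N.
Proof. by move=> mn; elim: d => // d IH; rewrite !expnS leq_mul. Qed.

Section GrowthEstimates.
Variables (G : zmodType) (S : {fset G}).
Hypotheses (genS : generates S) (symS : symmetric_subset S).

Lemma ball_sum r d (x : 'I_d -> G) :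
  (forall i, ball S r (x i)) -> ball S (d * r) (\sum_i x i).
Proof.
elim: d x => [|d IH] x xr; first by rewrite big_ord0; apply: ball0.
by rewrite big_ord_recl mulSn; apply: ballD => //; apply: IH.
Qed.

(** An additive map is bounded on the generators, hence grows at most linearly in
  the radius. *)
Lemma coord_ball (f : {additive G -> int}) :
  exists k : nat, forall r g, ball S r g -> (`|f g| <= k * r)%N.
Proof.
pose k := (\max_(x <- S) `|f x|)%N; exists k => r g /(ballP genS symS)[s [sr sS ->]].
apply: leq_trans (leq_mul (leqnn k) sr).
elim: s sS {sr} => [|x s IH] sS; first by rewrite big_nil raddf0.
rewrite big_cons raddfD /= mulnS.
have xk : (`|f x| <= k)%N.
  by apply: (leq_bigmax_seq (F := fun x => `|f x|%N)) => //; apply/sS/mem_head.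
have tri (a b : int) : (`|(a + b)%R| <= `|a| + `|b|)%N by lia.
apply: leq_trans (tri _ _) (leq_add xk (IH _)) => y ys.
by apply: sS; rewrite inE ys orbT.
Qed.

Variables (d : nat) (C : coordinates G d).

(** The lattice points with coordinates in [0, r] are sums of d multiples of basis
  elements, each of word length linear in r. *)
Lemma growth_ge : exists k, forall r, (r.+1 ^ d <= growth S (k * r))%N.
Proof.
have [k kP] := finite_sub_ball S [fset base C i | i in 'I_d]%fset.
exists (d * k)%N => r.
pose f (u : {ffun 'I_d -> 'I_r.+1}) : G := lattice_point C (fun i => u i).
rewrite -[X in (X ^ _)%N]card_ord -[X in (_ ^ X)%N]card_ord -card_ffun.
apply: (@card_fset_set_ge _ _ f); first exact: ball_finite.
  move=> u v uv; apply/ffunP => i; apply/val_inj.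
  have := congr1 (coord C i) uv; rewrite !coord_lattice_point.
  by case.
move=> _ [u _ <-]; rewrite -mulnA; apply: ball_sum => i.
apply: (@sub_ball _ _ (k * u i)); first by rewrite leq_mul2l -ltnS ltn_ord orbT.
by rewrite -pmulrn; apply: ballMn => //; apply: kP; apply/imfsetP; exists i.
Qed.

(** A ball of radius r has coordinates in an interval of length linear in r, and
  finitely many torsion parts. *)
Lemma growth_le : exists k, forall r, (growth S r <= k * r.+1 ^ d)%N.
Proof.
have fgG : finitely_generated G by exists S.
have [k kP] := choice (fun i => coord_ball (coord C i)).
pose K := (\max_i k i)%N.
exists ((2 * K).+1 ^ d * tors_order G)%N => r.
pose f (u : {ffun 'I_d -> 'I_(2 * K * r).+1} * tors_fset G) : G :=
  lattice_point C (fun i => (u.1 i)%:Z - (K * r)%:Z) + val u.2.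
apply: (@leq_trans #|{: {ffun 'I_d -> 'I_(2 * K * r).+1} * tors_fset G}|).
  apply: (@card_fset_set_le _ _ f) => g gr.
  have cg i : (`|(coord C i g + (K * r)%:Z)%R| < (2 * K * r).+1)%N.
    have := kP i r g gr; have : (k i * r <= K * r)%N.
      by rewrite leq_mul2r leq_bigmax orbT.
    lia.
  have tg : torsion_part C g \in tors_fset G.
    by rewrite in_tors_fset ?torsion_part_tors //; apply: tors_finite C fgG.
  exists ([ffun i => Ordinal (cg i)], [` tg]%fset) => //.
  rewrite /f /= [RHS](_ : _ = lattice_point C (coord C ^~ g) + torsion_part C g).
    congr (_ + _); apply: eq_lattice_point => i; rewrite ffunE /=.
    have := kP i r g gr; have : (k i * r <= K * r)%N.
      by rewrite leq_mul2r leq_bigmax orbT.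
    lia.
  by rewrite /torsion_part addrC subrK.
rewrite card_prod card_ffun !card_ord -cardfE -/(tors_order G) [leqRHS]mulnAC -expnMn leq_mul2r.
by apply/orP; right; apply: leq_wexp2r; lia.
Qed.

End GrowthEstimates.

(** Otherwise (r+1)^(d+1) would be at most a constant times (r+1)^d for all r; the
  constant itself is a radius that refutes this. *)
Lemma rank_le (G G' : zmodType) (S : {fset G}) (S' : {fset G'}) (d d' : nat)
    (C : coordinates G d) (C' : coordinates G' d') :
  generates S -> symmetric_subset S -> generates S' -> symmetric_subset S' ->
  (forall r, growth S r = growth S' r) -> (d' <= d)%N.
Proof.
move=> genS symS genS' symS' eqg.
have [k kP] := growth_le genS symS C; have [k' k'P] := growth_ge genS' symS' C'.
rewrite leqNgt; apply/negP => dd'.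
pose r := (k * k'.+1 ^ d)%N.
suff : (r.+1 ^ d.+1 <= r * r.+1 ^ d)%N.
  by rewrite expnS leq_pmul2r ?expn_gt0 // ltnn.
apply: (@leq_trans (r.+1 ^ d')); first by rewrite leq_pexp2l.
apply: leq_trans (k'P r) _; rewrite -eqg.
apply: leq_trans (kP _) _.
rewrite {2}/r -mulnA -expnMn leq_mul2l; apply/orP; right; apply: leq_wexp2r.
lia.
Qed.

(** The fixed points of negation satisfy 2x = 0, so they are torsion, and they all
  lie in a ball as soon as that ball contains tors G. *)
Lemma odd_growth (G : zmodType) (S : {fset G}) :
  generates S -> symmetric_subset S -> finite_set [set g : G | g \in tors G] ->
  exists r0, forall r, (r0 <= r)%N -> odd (growth S r) = odd (tors_order G).
Proof.
move=> genS symS finT.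
have [r0 r0P] := finite_sub_ball S (tors_fset G).
exists r0 => r r0r; rewrite /growth /tors_order.
rewrite (@odd_card_involution _ -%R) /=; first last.
- by move=> x _; rewrite opprK.
- move=> x; rewrite !in_growth //.
  by move=> /asboolP xr; apply/asboolP; apply: ballN.
rewrite [RHS](@odd_card_involution _ -%R) /=; first last.
- by move=> x _; rewrite opprK.
- by move=> x; rewrite !in_tors_fset // rpredN.
congr (odd #|` _|%fset); apply/fsetP=> x; rewrite !inE in_growth //.
have [xx|] := eqVneq; last by rewrite !andbF.
rewrite !andbT.
have xT : x \in tors_fset G.
  rewrite in_tors_fset //; apply/asboolP; exists 2%N; split=> //.
  by rewrite mulr2n -{1}xx addNr.
by rewrite xT; apply/asboolP/(sub_ball r0r)/r0P.
Qed.

(** * A generating set with prescribed balls *)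

Section TargetBalls.
Variables (G : zmodType) (d : nat) (C : coordinates G d.+1).
Variables (A : {fset G}) (L M : nat).
Hypotheses (L_gt0 : (0 < L)%N) (ltLM : (2 * L < M)%N).

(** The profile of a ball near its ends, i being the depth below the end. *)
Definition admissible (i : int) (t : G) : bool :=
  [|| (i == 0) && (t == 0), (i == L%:Z) && (t \notin A) | L%:Z < i].

Lemma admissible_ge0 i t : admissible i t -> 0 <= i.
Proof. by case/or3P => [/andP[/eqP-> _]|/andP[/eqP-> _]|]; lia. Qed.

Lemma admissible_deep i t : L%:Z < i -> admissible i t.
Proof. by move=> Li; apply/or3P/Or33. Qed.

Lemma admissible00 : admissible 0 0.
Proof. by rewrite /admissible !eqxx. Qed.

Lemma admissibleP i t : admissible i t -> (i = 0 /\ t = 0) \/ L%:Z <= i.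
Proof.
case/or3P => [/andP[/eqP-> /eqP->]|/andP[/eqP-> _]|/ltW]; [by left| |]; right => //.
Qed.

(** This is why the profile of the ends does not change with the radius: a sum with
  a nonzero depth on both sides has depth at least 2L > L, where everything is
  admissible. *)
Lemma admissibleD i j t u :
  admissible i t -> admissible j u -> admissible (i + j) (t + u).
Proof.
move=> it ju; have [[-> ->]|Li] := admissibleP it; first by rewrite !add0r.
have [[-> ->]|Lj] := admissibleP ju; first by rewrite !addr0.
by apply: admissible_deep; lia.
Qed.

(** The r-fold sums of the part of the generating set in Z x tors G: the depth is
  measured from the end rM or - rM on the side of x, and the profile is mirrored
  by t -> - t at the negative end so that the set is symmetric. *)
Definition slab (r : nat) (x : int) (t : G) : bool :=
  if 0 <= x then admissible ((r * M)%N%:Z - x) t else admissible ((r * M)%N%:Z + x) (- t).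

Lemma slab_deep r x t : (`|x| + L < r * M)%N -> slab r x t.
Proof. by move=> xr; rewrite /slab; case: ifP => _; apply: admissible_deep; lia. Qed.

Lemma slab_bound r x t : slab r x t -> (`|x| <= r * M)%N.
Proof. by rewrite /slab; case: ifP => x0 /admissible_ge0; lia. Qed.

Lemma slabN r x t : slab r (- x) (- t) = slab r x t.
Proof.
have [->|x0] := eqVneq x 0; last first.
  by rewrite /slab; case: ifP; case: ifP; rewrite ?opprK //; lia.
case: r => [|r].
  have L0 : (0 == L%:Z) = false by lia.
  by rewrite /slab oppr0 lexx mul0n subr0 /admissible oppr_eq0 L0.
by rewrite !slab_deep //; nia.
Qed.

(** On the same side depths add; on opposite sides the sum is at least M > L away
  from both ends. *)
Lemma slabD r x t y u :
  slab 1 x t -> slab r y u -> slab r.+1 (x + y) (t + u).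
Proof.
wlog x0 : x t y u / 0 <= x => [hyp xt yu|xt yu].
  have [/hyp|x0] := leP 0 x; first exact.
  by rewrite -slabN !opprD; apply: hyp; rewrite ?slabN //; lia.
have [y0|y0] := leP 0 y.
  move: xt yu; rewrite /slab x0 y0 addr_ge0 // => xt yu.
  rewrite (_ : _ - _ = ((1 * M)%N%:Z - x) + ((r * M)%N%:Z - y)); last by lia.
  exact: admissibleD.
have := slab_bound xt; have := slab_bound yu; case: r yu => [|r] yu yr xM; first by lia.
by apply: slab_deep; nia.
Qed.

(** A point far from 0 loses the extreme element (M, 0): this keeps its depth, or
  brings it to the other side of 0, deep inside the smaller slab.  A point close
  to 0 is already deep inside it.  The last clause serves to show that the removed u
  is torsion when t is. *)
Lemma slab_split r x t : slab r.+1 x t ->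
  exists y u, [/\ slab 1 y u, slab r (x - y) (t - u) & u = 0 \/ u = t].
Proof.
wlog x0 : x t / 0 <= x => [hyp xt|].
  have [/hyp|x0] := leP 0 x; first exact.
  have [||y [u [yu xyu uE]]] := hyp (- x) (- t); rewrite ?slabN //; first by lia.
  exists (- y), (- u); rewrite slabN -[slab r _ _]slabN !opprD !opprK; split=> //.
  by case: uE => ->; [left; rewrite oppr0|right; rewrite opprK].
case: r => [|r] xt.
  exists x, t; rewrite !subrr; split; [by []| |by right].
  by rewrite /slab subrr admissible00.
have [xL|Lx] := leP x L%:Z.
  exists 0, 0; rewrite !subr0; split; [| |by left].
    by apply: slab_deep; lia.
  by apply: slab_deep; nia.
exists M%:Z, 0; rewrite subr0; split; [| |by left].
  by rewrite /slab /= mul1n subrr admissible00.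
have [Mx|xM] := leP M%:Z x; last by apply: slab_deep; nia.
move: xt; rewrite /slab x0 subr_ge0 Mx.
rewrite (_ : (_ - x) = (r.+1 * M)%N%:Z - (x - M%:Z)) //; lia.
Qed.

(** The intended ball of radius r: the box [-r, r]^d times the slab. *)
Definition target_ball (r : nat) : set G := [set g |
  (forall j, (`|coord C (lift ord0 j) g| <= r)%N) /\
  slab r (coord C ord0 g) (torsion_part C g)].

Lemma target_ball_0 r : target_ball r 0.
Proof.
split=> [j|]; first by rewrite raddf0.
rewrite !raddf0; case: r => [|r]; last by apply: slab_deep; lia.
by rewrite /slab subrr admissible00.
Qed.

Lemma target_ball0_eq0 g : target_ball 0 g -> g = 0.
Proof.
move=> [cg gT].
have c0 : coord C ord0 g = 0 by have := slab_bound gT; lia.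
apply: (@coordinates_inj _ _ C) => [i|]; rewrite !raddf0.
  by case: (unliftP ord0 i) => [j ->|-> //]; have := cg j; lia.
move: gT; rewrite c0 /slab subrr /= => /admissibleP[[]//|]; lia.
Qed.

Lemma target_ballN r g : target_ball r g -> target_ball r (- g).
Proof. by move=> [cg gT]; split=> [j|]; rewrite !raddfN ?slabN // abszN. Qed.

Lemma target_ballD r g h : target_ball 1 g -> target_ball r h -> target_ball r.+1 (g + h).
Proof.
move=> [cg gT] [ch hT]; split=> [j|]; rewrite !raddfD; last exact: slabD.
have tri (a b : int) : (`|(a + b)%R| <= `|a| + `|b|)%N by lia.
exact: leq_trans (tri _ _) (leq_add (cg j) (ch j)).
Qed.

(** Each of the other coordinates moves one step towards 0 when it is extreme. *)
Lemma target_ball_split r g :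
  target_ball r.+1 g -> exists2 h, target_ball 1 h & target_ball r (g - h).
Proof.
move=> [cg gT]; have [y [u [yu yu' uE]]] := slab_split gT.
have u_tors : u \in tors G by case: uE => ->; [exact: rpred0|exact: torsion_part_tors].
pose step (c : int) : int := if (`|c| <= r)%N then 0 else if 0 <= c then 1 else -1.
have stepP (c : int) : (`|c| <= r.+1)%N -> (`|(c - step c)%R| <= r)%N.
  by rewrite /step; case: ifP; [|case: ifP]; lia.
pose a i := if unlift ord0 i is Some j then step (coord C i g) else y.
have a0 : a ord0 = y by rewrite /a unlift_none.
have a_lift j : a (lift ord0 j) = step (coord C (lift ord0 j) g) by rewrite /a liftK.
pose h := lattice_point C a + u.
have ch i : coord C i h = a i.
  by rewrite raddfD /= coord_lattice_point (coord0_tors _ _ u_tors) addr0.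
have th : torsion_part C h = u.
  by rewrite raddfD /= torsion_part_lattice_point add0r torsion_part_id.
have tgh : torsion_part C (g - h) = torsion_part C g - u by rewrite raddfB /= th.
exists h; split=> [j|]; rewrite ?tgh ?th ?raddfB ?ch ?a0 ?a_lift //=.
  by rewrite /step; do 2 case: ifP => //.
exact: stepP.
Qed.

Lemma target_ball_exhausts g : exists r, target_ball r g.
Proof.
exists (\sum_i `|coord C i g| + L).+1%N; split=> [j|].
  by rewrite (bigD1 (lift ord0 j)) //= -addnA -addnS leq_addr.
apply: slab_deep; rewrite (bigD1 ord0) //=; nia.
Qed.

Hypotheses (finT : finite_set [set g : G | g \in tors G]) (sAT : (A `<=` tors_fset G)%fset).

Definition depth_count (i : nat) : nat := #|[set t : tors_fset G | admissible i%:Z (val t)]%SET|.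

Lemma depth_countN (i : nat) :
  #|[set t : tors_fset G | admissible i%:Z (- val t)]%SET| = depth_count i.
Proof.
have NT (t : tors_fset G) : - val t \in tors_fset G.
  by have := valP t; rewrite !in_tors_fset // rpredN.
pose opp (t : tors_fset G) : tors_fset G := [` NT t]%fset.
have oppK : involutive opp by move=> t; apply/val_inj; rewrite /= opprK.
rewrite /depth_count -[RHS](card_preimset _ (inv_inj oppK)); apply: eq_card => t.
by rewrite !inE.
Qed.

(** One element at depth 0, none strictly between 0 and L, the complement of A at
  depth L, and all of tors G at each greater depth. *)
Lemma sum_depth_count k :
  (\sum_(i < (L + k).+1) depth_count i = 1 + (tors_order G - #|` A|%fset) + tors_order G * k)%N.
Proof.
have cardT : #|{: tors_fset G}| = tors_order G by rewrite -cardfE.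
elim: k => [|k IH]; last first.
  rewrite addnS big_ord_recr /= {}IH mulnS -addnA; congr (_ + _)%N.
  rewrite addnC -cardT -cardsT; congr (_ + _)%N; apply: eq_card => t.
  by rewrite !inE admissible_deep //; lia.
rewrite addn0 muln0 addn0 big_ord_recr /=; congr (_ + _)%N; last first.
  rewrite -(card_fsub sAT) -cardT -(cardsC (fsub (tors_fset G) A)) addKn; apply: eq_card => t.
  rewrite !inE /admissible eqxx ltxx orbF.
  by rewrite (_ : (L%:Z == 0) = false) //; lia.
rewrite -(ltn_predK L_gt0) big_ord_recl big1 ?addn0 => [|i _].
  have T0 : 0 \in tors_fset G by rewrite in_tors_fset ?rpred0.
  rewrite /= -(cards1 [` T0]%fset); apply: eq_card => t.
  rewrite !inE /admissible eqxx -val_eqE /=.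
  by rewrite (_ : (0%:Z == L%:Z) = false) ?orbF //; lia.
apply: eq_card0 => t; have := ltn_ord i; rewrite !inE lift0 => iL.
by apply/negP => /or3P[/andP[+ _]|/andP[+ _]|]; lia.
Qed.

(** Points of the slab are indexed by their end and their depth: depths i < rM at
  the negative end, depths i <= rM at the positive end, so that x = 0 is counted
  once, at the positive end. *)
Lemma card_target_ball r :
  finite_set (target_ball r) /\ #|` fset_set (target_ball r)|%fset =
    ((2 * r).+1 ^ d * (\sum_(i < r * M) depth_count i + \sum_(i < (r * M).+1) depth_count i))%N.
Proof.
set K := (r * M)%N.
pose pos (x : 'I_K + 'I_K.+1) : int :=
  match x with inl i => i%:Z - K%:Z | inr i => K%:Z - i%:Z end.
have pos_inj : injective pos.
  move=> [i|i] [j|j] /= e; have := ltn_ord i; have := ltn_ord j; try lia; move=> _ _;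
  by congr (_ _); apply/val_inj => /=; lia.
pose F := ({ffun 'I_d -> 'I_(2 * r).+1} * (('I_K + 'I_K.+1) * tors_fset G))%type.
pose a (u : F) i := if unlift ord0 i is Some j then (u.1 j)%:Z - r%:Z else pos u.2.1.
pose f (u : F) := lattice_point C (a u) + val u.2.2.
have uT (u : F) : val u.2.2 \in tors G by have := valP u.2.2; rewrite in_tors_fset.
have cf u i : coord C i (f u) = a u i.
  by rewrite raddfD /= coord_lattice_point (coord0_tors _ _ (uT u)) addr0.
have tf u : torsion_part C (f u) = val u.2.2.
  by rewrite raddfD /= torsion_part_lattice_point add0r torsion_part_id ?uT.
have a0 u : a u ord0 = pos u.2.1 by rewrite /a unlift_none.
have a_lift u j : a u (lift ord0 j) = (u.1 j)%:Z - r%:Z by rewrite /a liftK.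
pose E := [set p : ('I_K + 'I_K.+1) * tors_fset G | slab r (pos p.1) (val p.2)]%SET.
have [|g|finR ->] := @card_fset_set_image F G
  (finset.setX [set: {ffun 'I_d -> 'I_(2 * r).+1}]%SET E) f (target_ball r).
- move=> [u [x t]] [u' [x' t']] _ _ e; congr (_, (_, _)).
  + apply/ffunP => j; apply/val_inj => /=.
    by have := congr1 (coord C (lift ord0 j)) e; rewrite !cf !a_lift /=; lia.
  + by have := congr1 (coord C ord0) e; rewrite !cf !a0 => /pos_inj.
  + by have := congr1 (torsion_part C) e; rewrite !tf => /val_inj.
- split=> [[cg gT]|[u]]; last first.
    rewrite !inE /= => uE ->; split=> [j|]; rewrite ?cf ?a0 ?tf ?a_lift //.
    by have := ltn_ord (u.1 j); move: (nat_of_ord _) => m; lia.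
  have gU j : (`|(coord C (lift ord0 j) g + r%:Z)%R| < (2 * r).+1)%N.
    by have := cg j; lia.
  have [x xE] : exists x, pos x = coord C ord0 g.
    have := slab_bound gT; case: (leP 0 (coord C ord0 g)) => c0 cK.
      have lt : (`|(K%:Z - coord C ord0 g)%R| < K.+1)%N by lia.
      by exists (inr (Ordinal lt)) => /=; lia.
    have lt : (`|(K%:Z + coord C ord0 g)%R| < K)%N by lia.
    by exists (inl (Ordinal lt)) => /=; lia.
  have tg : torsion_part C g \in tors_fset G by rewrite in_tors_fset ?torsion_part_tors.
  exists ([ffun j => Ordinal (gU j)], (x, [` tg]%fset)); first by rewrite !inE /= xE.
  apply: (@coordinates_inj _ _ C) => [i|]; rewrite ?tf // cf.
  case: (unliftP ord0 i) => [j ->|->]; rewrite ?a0 // a_lift ffunE /=.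
  by have := cg j; lia.
split=> //; rewrite cardsX cardsT card_ffun !card_ord; congr (_ * _)%N.
have -> : #|E| = (\sum_(x : 'I_K + 'I_K.+1) \sum_(t : tors_fset G | slab r (pos x) (val t)) 1)%N.
  by rewrite pair_big_dep -sum1_card; apply: eq_bigl => p; rewrite inE.
rewrite big_sumType /=; congr (_ + _)%N; apply: eq_bigr => i _; rewrite sum1_card.
  rewrite -depth_countN; apply: eq_card => t; rewrite !inE /slab.
  have iK := ltn_ord i; rewrite (_ : (0 <= _) = false); last by lia.
  by congr admissible; lia.
apply: eq_card => t; rewrite !inE /slab.
have iK := ltn_ord i; rewrite (_ : (0 <= _) = true); last by lia.
by congr admissible; lia.
Qed.

(** The target balls satisfy B(r+1) = B(1) + B(r), so they are the balls of the
  generating set B(1). *)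
Lemma target_ball_generating_set :
  exists S : {fset G}, [/\ generates S, symmetric_subset S, growth S 0 = 1%N &
    forall r, (0 < r)%N -> growth S r =
      ((2 * r).+1 ^ d * (2 + 2 * (tors_order G - #|` A|%fset) +
          tors_order G * (r * M - L) + tors_order G * (r * M - L.+1)))%N].
Proof.
have [fin1 _] := card_target_ball 1.
pose S := fset_set (target_ball 1).
have memS g : g \in S <-> target_ball 1 g.
  by rewrite in_fset_set //; split=> [/set_mem|/mem_set].
have target_ballP r g : target_ball r g <->
    exists s : seq G, [/\ (size s <= r)%N, {subset s <= S} & g = \sum_(x <- s) x].
  split.
    elim: r g => [|r IH] g => [/target_ball0_eq0->|]; first by exists [::]; rewrite big_nil.
    move=> /target_ball_split[h h1 /IH[s [sr sS sE]]]; exists (h :: s); split=> //.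
      by move=> x; rewrite inE => /predU1P[->|/sS//]; apply/memS.
    by rewrite big_cons -sE addrC subrK.
  move=> [s [sr sS ->]]; elim: s r sr sS => [|x s IH] r sr sS.
    by rewrite big_nil; apply: target_ball_0.
  case: r sr => // r sr; rewrite big_cons; apply: target_ballD.
    exact/memS/sS/mem_head.
  by apply: IH => // y ys; apply: sS; rewrite inE ys orbT.
have genS : generates S.
  move=> g; have [r /target_ballP[s [_ sS gE]]] := target_ball_exhausts g.
  by exists s; split=> // x /sS; left.
have symS : symmetric_subset S by move=> g /memS/target_ballN/memS.
have ballE r : ball S r = target_ball r.
  by rewrite predeqE => g; apply: iff_trans (ballP genS symS r g) (iff_sym (target_ballP r g)).
exists S; split=> // [|r r0]; rewrite /growth ballE.
  suff -> : target_ball 0 = [set` [fset 0]%fset] by rewrite set_fsetK cardfs1.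
  rewrite predeqE => g /=; rewrite inE; split=> [/target_ball0_eq0/eqP //|/eqP->].
  exact: target_ball_0.
have [_ ->] := card_target_ball r; congr (_ * _)%N.
have rM : (L < r * M)%N by nia.
have e1 : (r * M).+1 = (L + (r * M - L)).+1 by lia.
have e2 : r * M = (L + (r * M - L.+1)).+1 by lia.
have := sum_depth_count (r * M - L); rewrite -e1 => ->.
have := sum_depth_count (r * M - L.+1); rewrite -e2 => ->.
lia.
Qed.

End TargetBalls.

(** * Equal growth from equal invariants *)

(** With L = n', M = 3n' and L' = n, M' = 3n the products nL and nM are the same for
  both groups, and M > 2L as required of the profile.  At most one of the two
  truncated differences is nonzero; as n and n' have the same parity, halving it
  makes n - 2|A| equal to n' - 2|A'|. *)
Lemma equal_growth (G G' : zmodType) (d : nat)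
    (C : coordinates G d.+1) (C' : coordinates G' d.+1) :
  finite_set [set g : G | g \in tors G] -> finite_set [set g : G' | g \in tors G'] ->
  tors_order G = tors_order G' %[mod 2] ->
  exists (S : {fset G}) (S' : {fset G'}),
     [/\ generates S, symmetric_subset S, generates S', symmetric_subset S' &
         forall r : nat, growth S r = growth S' r].
Proof.
move=> finT finT' parity.
have tors_gt0 (H : zmodType) : finite_set [set g : H | g \in tors H] -> (0 < tors_order H)%N.
  by move=> finH; rewrite cardfs_gt0; apply/fset0Pn; exists 0; rewrite in_tors_fset ?rpred0.
have n0 := tors_gt0 _ finT; have n'0 := tors_gt0 _ finT'.
have [|A sA cA] := @fsubset_of_card _ (tors_fset G) (tors_order G - tors_order G')./2.
  rewrite -/(tors_order G); lia.
have [|A' sA' cA'] := @fsubset_of_card _ (tors_fset G') (tors_order G' - tors_order G)./2.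
  rewrite -/(tors_order G'); lia.
have [|S [genS symS S0 Sr]] :=
  @target_ball_generating_set _ _ C A (tors_order G') (3 * tors_order G') n'0 _ finT sA;
  first by lia.
have [|S' [genS' symS' S0' Sr']] :=
  @target_ball_generating_set _ _ C' A' (tors_order G) (3 * tors_order G) n0 _ finT' sA';
  first by lia.
exists S, S'; split=> // -[|r]; first by rewrite S0.
rewrite Sr // Sr' // cA cA'; congr (_ * _)%N.
move: (tors_order G) (tors_order G') n0 n'0 parity => n n' n0 n'0 parity.
(* Distributing n and n' makes the multiples of n * n' and (r + 1) * n * n' on the
   two sides match; what remains is linear arithmetic on n, n' and the halves. *)
rewrite !mulnBr !mulnS ![(n' * (r.+1 * _))%N]mulnCA ![(n * (r.+1 * _))%N]mulnCA.
nia.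
Qed.

Theorem theorem1p3 (G G' : zmodType)
    (fgG : finitely_generated G) (fgG' : finitely_generated G')
    (rkG : rk G <> 0%N) (rkG' : rk G' <> 0%N) :
  (exists (S : {fset G}) (S' : {fset G'}),
     [/\ generates S, symmetric_subset S,
         generates S', symmetric_subset S' &
         forall r : nat, growth S r = growth S' r])
  <->
  (rk G = rk G' /\ tors_order G = tors_order G' %[mod 2]).
Proof.
have [C] := rk_coordinates rkG; have [C'] := rk_coordinates rkG'.
have finT := tors_finite C fgG; have finT' := tors_finite C' fgG'.
split=> [[S [S' [genS symS genS' symS' eqg]]]|[eq_rk parity]].
  split.
    apply/eqP; rewrite eqn_leq (rank_le C' C genS' symS' genS symS) //.
    by rewrite (rank_le C C' genS symS genS' symS').
  have [r r_odd] := odd_growth genS symS finT.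
  have [r' r'_odd] := odd_growth genS' symS' finT'.
  by rewrite !modn2 -(r_odd (maxn r r')) ?leq_maxl // eqg r'_odd ?leq_maxr.
move: C C'; rewrite -eq_rk; case: (rk G) rkG => // d _ C C'.
exact: equal_growth C C' finT finT' parity.
Qed.
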